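(* Let $U$ be a countably infinite set, let $\mathrm{G}$ be an algebraically finite subgroup of $\mathfrak{S}(U)$ and let $F$ be a finite subset of $U$. Then there exist two copies $C,D\in\overline{\mathrm{G}}[U]$ with $C\cap D=\mathfrak{ac}(F)$.
   Context: $\overline{\mathrm{G}}$ is the closure of $\mathrm{G}$ in $U^U$ for the function (pointwise convergence) topology, i.e. the set of maps $f:U\to U$ such that for every finite $E\subseteq U$ some $g\in\mathrm{G}$ agrees with $f$ on $E$; copies are the elements of $\overline{\mathrm{G}}[U]=\{f[U]\mid f\in\overline{\mathrm{G}}\}$. For $F\subseteq U$, $\mathrm{G}\langle F\rangle=\{g\in\mathrm{G}\mid g(x)=x \text{ for all } x\in F\}$. For finite $F$, the algebraic closure $\mathfrak{ac}(F)$ is the union of all finite orbits of the action of $\mathrm{G}\langle F\rangle$ on $U$. $\mathrm{G}$ is algebraically finite if $\mathfrak{ac}(F)$ is finite for every finite $F\subseteq U$. *)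

(* Defs.v *)
From mathcomp Require Import all_boot all_classical.
From mathcomp Require Import topology_structure discrete_topology.
From mathcomp Require Import supremum_topology function_spaces.

Set Implicit Arguments.
Unset Strict Implicit.
Unset Printing Implicit Defensive.

Local Open Scope classical_set_scope.

Section PermutationGroups.
Variable U : Type.
Implicit Types (G : set (U -> U)) (F : set U).

Definition perm_subgroup G : Prop :=
  [/\ forall g, G g -> bijective g,
      G id,
      forall g h, G g -> G h -> G (g \o h) &
      forall g h, G g -> cancel g h -> cancel h g -> G h].

(* See fun_closureE for the agreement with the topological closure. *)
Definition fun_closure G : set (U -> U) :=
  [set f | forall E : set U, finite_set E ->
     exists2 g, G g & forall x, E x -> g x = f x].

Definition copies G : set (set U) := [set range f | f in fun_closure G].

Definition fix_stab G F : set (U -> U) :=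
  [set g | G g /\ forall x, F x -> g x = x].

Definition orbit G (x : U) : set U := [set g x | g in G].

Definition ac G F : set U :=
  \bigcup_(O in [set O | range (orbit (fix_stab G F)) O /\ finite_set O]) O.

Definition algebraically_finite G : Prop :=
  forall F, finite_set F -> finite_set (ac G F).

End PermutationGroups.

Lemma fun_closureE (U : choiceType) (G : set (U -> U)) :
  fun_closure G = closure (G : set {ptws U -> discrete_topology U}).
Proof.
pose ptwsU : topologicalType := {ptws U -> discrete_topology U}.
have nbhs_agree (f : ptwsU) (s : seq U) :
    nbhs f [set g : ptwsU | forall x, x \in s -> g x = f x].
  elim: s => [|a s IHs]; first by apply: filterS filterT => g _ x.
  have nfa : nbhs f [set g : ptwsU | g a = f a].
    have := @proj_continuous U (fun=> discrete_topology U) a f [set f a].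
    by apply; exact: discrete_set1.
  apply: filterS (filterI nfa IHs) => g [ga gs] x.
  by rewrite inE => /predU1P[->//|]; exact: gs.
apply/seteqP; split => f /= clf.
  pose A (E : set U) := [set g : U -> U | forall x, E x -> g x = f x].
  pose Phi : set_system (U -> U) := filter_from (@finite_set U) A.
  have PhiF : Filter Phi.
    apply: filter_from_filter; first by exists set0; exact: finite_set0.
    move=> E E' finE finE'; exists (E `|` E'); first by rewrite finite_setU.
    by move=> g Ag; split=> x Ex; apply: Ag; [left|right].
  have Phif : Phi --> (f : ptwsU).
    apply/cvg_sup => t; move=> B; rewrite nbhsE => -[O [[V _ <-] Vft] OB].
    exists [set t]; first exact: finite_set1.
    move=> g gt; by apply: OB; rewrite /preimage /= (gt t erefl).
  move=> B /Phif[E finE AB]; have [g Gg gf] := clf E finE.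
  by exists g; split=> //; apply: AB.
move=> E /finite_seqP[s ->].
have [g [Gg gf]] := clf _ (nbhs_agree f s).
by exists g.
Qed.

(* Main.v *)
(** Neumann's separation lemma: if a group acts with infinite orbits on the
    points of a finite set [A], some element moves [A] off a given finite set
    [B].  Two sequences of elements of [G] fixing [F] are built along an
    exhaustion [E n] of [U] by finite sets starting from [F]; the separation
    lemma, applied to the stabilizer of [E n], keeps the images of [ac (E n)]
    under the two sequences disjoint outside of [ac F].  The ranges of the two
    pointwise limits are the required copies. *)
Require Import Defs.
From mathcomp Require Import all_boot all_classical.

Local Open Scope classical_set_scope.
Local Open Scope card_scope.

Section AlgebraicClosure.
Context {U : Type}.
Implicit Types (G H : set (U -> U)) (E F A B : set U).

Lemma perm_subgroup_fix_stab G F :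
  perm_subgroup G -> perm_subgroup (fix_stab G F).
Proof.
move=> [Gbij G1 GM GV]; split.
- by move=> g [/Gbij].
- by split.
- move=> g h [Gg gF] [Gh hF]; split; first exact: GM.
  by move=> x Fx /=; rewrite hF// gF.
- move=> g h [Gg gF] gK hK; split; first exact: GV gK hK.
  by move=> x Fx; rewrite -{1}(gF x Fx) gK.
Qed.

Lemma perm_subgroup_inv {G} : perm_subgroup G -> forall {g}, G g ->
  exists h, [/\ G h, cancel g h & cancel h g].
Proof.
move=> [Gbij _ _ GV] g Gg; have [h gK hK] := Gbij _ Gg.
by exists h; split=> //; exact: GV gK hK.
Qed.

Lemma perm_subgroup_inj {G g} : perm_subgroup G -> G g -> injective g.
Proof. by move=> [Gbij _ _ _] /Gbij/bij_inj. Qed.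

Lemma finite_perm_preimage G g B :
  perm_subgroup G -> G g -> finite_set B -> finite_set (g @^-1` B).
Proof.
move=> hG Gg; apply: finite_preimage => x y _ _.
exact: (perm_subgroup_inj hG Gg).
Qed.

Lemma orbit_perm H h x : perm_subgroup H -> H h -> Defs.orbit H (h x) = Defs.orbit H x.
Proof.
move=> hH Hh; have [k [Hk hK _]] := perm_subgroup_inv hH Hh.
have [_ _ HM _] := hH.
apply/seteqP; split => _ [g Hg <-].
  by exists (g \o h) => //; exact: HM.
by exists (g \o k); [exact: HM | rewrite /= hK].
Qed.

(** All points of an orbit share that orbit, so a finite orbit containing [x] must be the orbit of
    [x] itself. *)
Lemma acE G F x : perm_subgroup G ->
  ac G F x <-> finite_set (Defs.orbit (fix_stab G F) x).
Proof.
move=> hG; have hH := perm_subgroup_fix_stab _ F hG.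
split=> [[_ [[y _ <-] finO]]|finO].
  by move=> [h Hh <-]; rewrite orbit_perm.
exists (Defs.orbit (fix_stab G F) x); first by split=> //; exists x.
by have [_ H1 _ _] := hH; exists id.
Qed.

Lemma sub_ac G F : perm_subgroup G -> F `<=` ac G F.
Proof.
move=> hG x Fx; apply/acE => //; apply: (sub_finite_set _ (finite_set1 x)).
by move=> _ [g [_ gF] <-] /=; exact: gF.
Qed.

Lemma ac_stable G F g x : perm_subgroup G -> fix_stab G F g ->
  ac G F x -> ac G F (g x).
Proof.
move=> hG Hg /(acE _ _ _ hG) finO; apply/(acE _ _ _ hG).
by rewrite orbit_perm//; exact: perm_subgroup_fix_stab.
Qed.

End AlgebraicClosure.

(* By induction on [A]: for [b] in [B] with infinite orbit fix [h b] moving [b]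
   out of [B].  If [g] moves [A] off [B] and all the preimages of [B] by the
   [h b], then either [g], or [h b \o g] with [b = g a], works for [a |` A]. *)
Lemma neumann_separation (U : Type) (H : set (U -> U)) (A B : set U) :
  perm_subgroup H -> finite_set A ->
  (forall a, A a -> infinite_set (Defs.orbit H a)) ->
  finite_set B -> exists2 g, H g & forall a, A a -> ~ B (g a).
Proof.
elim/Pchoice: U => U in H A B *.
move=> hH /finite_seqP[s ->]; have [_ H1 HM _] := hH.
elim: s => [|a s IHs] in B *; first by move=> _ _; exists id.
move=> infs finB.
have /choice[h hP] (b : U) : exists h : U -> U,
    H h /\ (infinite_set (Defs.orbit H b) -> ~ B (h b)).
  have [finO|infO] := pselect (finite_set (Defs.orbit H b)); first by exists id.
  have [_ [[k Hk <-] nBk]] : exists y, Defs.orbit H b y /\ ~ B y.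
    apply: contrapT => /forallNP nO; apply/infO/(sub_finite_set _ finB) => y Oy.
    by apply: contrapT => nBy; exact: (nO y).
  by exists k.
have finhB : finite_set (B `|` \bigcup_(b in B) (h b @^-1` B)).
  rewrite finite_setU; split=> //; apply: bigcup_finite => // b _.
  by apply: finite_perm_preimage hH _ finB; have [] := hP b.
have [|g Hg gB] := IHs _ _ finhB.
  by move=> x sx; apply: infs; rewrite /= inE [x \in s]sx orbT.
have [Bga|nBga] := pselect (B (g a)).
  have [Hh hga] := hP (g a).
  exists (h (g a) \o g) => [|x /=]; first exact: HM.
  rewrite inE => /predU1P[->|sx].
    by apply: hga; rewrite orbit_perm//; apply: infs; rewrite /= mem_head.
  by move=> Bx; apply: (gB x sx); right; exists (g a).
exists g => // x /=; rewrite inE => /predU1P[->//|sx] Bx.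
by apply: (gB x sx); left.
Qed.

Lemma perm_extension_avoiding (U : Type) (G : set (U -> U)) (E E' B : set U) g :
  perm_subgroup G -> algebraically_finite G ->
  finite_set E' -> finite_set B -> G g ->
  exists g', [/\ G g', forall x, E x -> g' x = g x &
    forall x, ac G E' x -> B (g' x) ->
      exists2 y, ac G E y & g y = g' x].
Proof.
move=> hG hfin finE' finB Gg; have [_ _ GM _] := hG.
have finA : finite_set (ac G E' `\` ac G E) by apply/finite_setD/hfin.
have [|k [Gk kE] kB] := neumann_separation U (fix_stab G E) _ (g @^-1` B)
  (perm_subgroup_fix_stab _ _ hG) finA _ (finite_perm_preimage _ _ _ hG Gg finB).
  by move=> x [_ nEx] finO; apply: nEx; apply/acE.
exists (g \o k); split=> [|x Ex|x E'x Bx]; first exact: GM.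
  by rewrite /= kE.
have [Ex|nEx] := pselect (ac G E x); last by case: (kB x).
by exists (k x) => //; exact: ac_stable.
Qed.

Theorem theorem8p7 (U : Type) (G : set (U -> U)) (F : set U)
    (hU : [set: U] #= [set: nat])
    (hG : perm_subgroup G) (hfin : algebraically_finite G)
    (hF : finite_set F) :
  exists C D : set U, [/\ copies G C, copies G D & C `&` D = ac G F].
Proof.
have [i i_inj] : exists i : U -> nat, injective i.
  have /pcard_leP[i] : [set: U] #<= [set: nat].
    by move: hU; rewrite card_eq_le => /andP[].
  by exists i => x y ixy; apply: (@inj _ _ _ i); rewrite ?inE.
pose E n := F `|` i @^-1` `I_n.
have finE n : finite_set (E n).
  rewrite finite_setU; split=> //; apply: finite_preimage (finite_II n).
  by move=> x y _ _ /i_inj.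
have E_S n x : E n x -> E n.+1 x.
  by case=> [Fx|/= /ltnW]; [left|right].
have E_bound Z : finite_set Z -> exists n, forall x, Z x -> E n x.
  move=> finZ; have /finite_seqP[s sE] := finite_image i finZ.
  exists (\max_(j <- s) j).+1 => x Zx; right => /=; rewrite ltnS.
  have : [set` s] (i x) by rewrite -sE; exists x.
  by move=> /= si; exact: (@leq_bigmax_seq _ s xpredT id).
pose inv n (p : (U -> U) * (U -> U)) := [/\ fix_stab G F p.1, fix_stab G F p.2 &
  forall x y, ac G (E n) x -> ac G (E n) y -> p.1 x = p.2 y -> ac G F (p.1 x)].
have step n p : inv n p -> exists q, [/\ inv n.+1 q,
    forall x, E n x -> q.1 x = p.1 x & forall x, E n x -> q.2 x = p.2 x].
  case: p => g h [/= [Gg gF] [Gh hF'] ghF].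
  (* The order matters: [g'] avoids the old image [h @] ac G (E
     n)[, then]h'[avoids the new, larger image]g' @[ac G (E n.+1)]. *)
  have [g' [Gg' g'E g'B]] := perm_extension_avoiding _ _ (E n) (E n.+1) _ g
    hG hfin (finE n.+1) (finite_image h (hfin _ (finE n))) Gg.
  have [h' [Gh' h'E h'B]] := perm_extension_avoiding _ _ (E n) (E n.+1) _ h
    hG hfin (finE n.+1) (finite_image g' (hfin _ (finE n.+1))) Gh.
  exists (g', h'); split=> //; split=> /=.
  - by split=> // x Fx; rewrite g'E ?gF//; left.
  - by split=> // x Fx; rewrite h'E ?hF'//; left.
  move=> x y Ex Ey g'xh'y.
  (* A collision of [g'] and [h'] is traced back, first through [h'] and then through [g'], to a
     collision of [g] and [h] on [ac G (E n)]. *)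
  have [z Ez hz] : exists2 z, ac G (E n) z & h z = h' y.
    by apply: h'B => //; exists x.
  have [t Et gt] : exists2 t, ac G (E n) t & g t = g' x.
    by apply: g'B => //; exists z => //; rewrite hz.
  by rewrite -gt; apply: (ghF t z) => //; rewrite gt hz.
have /choice[next nextP] (np : nat * ((U -> U) * (U -> U))) :
    exists q, inv np.1 np.2 -> [/\ inv np.1.+1 q,
      forall x, E np.1 x -> q.1 x = np.2.1 x &
      forall x, E np.1 x -> q.2 x = np.2.2 x].
  case: np => n p /=.
  have [/step[q qP]|ninv] := pselect (inv n p); first by exists q.
  by exists p.
pose s := nat_rect (fun=> _) (@id U, @id U) (fun n p => next (n, p)).
have G1 : G id by case: hG.
(* At stage 0 both maps are the identity and [E 0 = F], so common values are in [ac G F]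
   trivially. *)
have sinv n : inv n (s n).
  elim: n => [|n IHn]; last by have [] := nextP (n, s n) IHn.
  have E0 : E 0 = F by apply/seteqP; split=> [x []//|x Fx]; left.
  by split=> //; rewrite E0.
have s_stable n m x : (n <= m)%N -> E n x ->
    (s m).1 x = (s n).1 x /\ (s m).2 x = (s n).2 x.
  move=> /subnK <- Enx; elim: (m - n)%N => [//|k [IH1 IH2]].
  have Ekx : E (k + n)%N x.
    by elim: k {IH1 IH2} => // k IHk; exact: E_S.
  have [_ /= -> // -> //] := nextP (k + n, s (k + n))%N (sinv _).
have E_i x : E (i x).+1 x by right => /=.
(* The value at [x] is frozen once [x] enters the exhaustion, which happens by stage [(i x).+1]
   since [E n] takes indices strictly below [n]. *)
pose f x := (s (i x).+1).1 x; pose f' x := (s (i x).+1).2 x.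
have s_lim n x : E n x -> (s n).1 x = f x /\ (s n).2 x = f' x.
  move=> Enx; have [le|/ltnW le] := leqP n (i x).+1.
    by have [] := s_stable _ _ _ le Enx.
  by have [] := s_stable _ _ _ le (E_i x).
have sub_range (u : U -> U) :
    (forall n, exists2 g, fix_stab G F g & forall x, E n x -> g x = u x) ->
    fun_closure G u /\ ac G F `<=` range u.
  move=> u_lim; split=> [Z /E_bound[n ZE]|x acx].
    have [g [Gg _] gu] := u_lim n; exists g => // x /ZE; exact: gu.
  (* Some stage contains the finite set [ac G F]. There [u] agrees with some [g] fixing [F], whose
     inverse [k] preserves [ac G F], so [k x] is a preimage of [x] under [u] too. *)
  have [n acE'] := E_bound _ (hfin F hF); have [g Hg gu] := u_lim n.
  have [k [Hk _ kK]] := perm_subgroup_inv (perm_subgroup_fix_stab _ F hG) Hg.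
  exists (k x) => //; rewrite -gu ?kK//.
  by apply: acE'; exact: ac_stable.
have [clf acf] : fun_closure G f /\ ac G F `<=` range f.
  apply: sub_range => n; exists (s n).1; first by have [] := sinv n.
  by move=> x /s_lim[].
have [clf' acf'] : fun_closure G f' /\ ac G F `<=` range f'.
  apply: sub_range => n; exists (s n).2; first by have [] := sinv n.
  by move=> x /s_lim[].
exists (range f), (range f'); split; [by exists f | by exists f' |].
apply/seteqP; split=> [z [[x _ fx] [y _ fy]]|z acz]; last first.
  by split; [exact: acf | exact: acf'].
(* At a stage containing both [x] and [y] the limits are already attained, and the invariant applies
   to their common value. *)
have [n xyE] := E_bound _ (finite_set2 x y).
have Ex : E n x by apply: xyE; left.
have Ey : E n y by apply: xyE; right.
have [_ _ disj] := sinv n.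
have [sx _] := s_lim _ _ Ex; have [_ sy] := s_lim _ _ Ey.
by rewrite -fx -sx; apply: (disj x y); rewrite ?sx ?sy ?fx//; exact: sub_ac.
Qed.
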